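(* Let $d\ge 2$ and $n\ge 2d$ be integers. The number of crossing pairs of hyperedges of the complete $d$-uniform hypergraph $K^d_n$ when all its $n$ vertices are placed at distinct points of the $d$-dimensional moment curve in $\mathbb{R}^d$ is $\Theta\!\left(\dfrac{4^d}{\sqrt{d}}\right)\binom{n}{2d}$; that is, there exist constants $C_1,C_2>0$ and an integer $d_0$ such that for all $d\ge d_0$, all $n\ge 2d$, and every placement of the $n$ vertices at distinct points of the moment curve, this number lies between $C_1\frac{4^d}{\sqrt d}\binom{n}{2d}$ and $C_2\frac{4^d}{\sqrt d}\binom{n}{2d}$.
   Context: The $d$-dimensional moment curve is $\gamma=\{(t,t^2,\ldots,t^d): t\in\mathbb{R}\}\subset\mathbb{R}^d$. The complete $d$-uniform hypergraph $K^d_n$ has $n$ vertices, and its hyperedges are all $d$-element subsets of the vertex set; each hyperedge is drawn as the $(d-1)$-simplex that is the convex hull of its $d$ vertices. Two hyperedges form a crossing pair if they are vertex-disjoint and the corresponding simplices have a common point in their relative interiors. Pairs of hyperedges are unordered. *)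

(* Defs.v *)
From HB Require Import structures.
From mathcomp Require Import all_boot all_order all_algebra.
From mathcomp Require Import all_classical all_reals all_analysis.

Set Implicit Arguments.
Unset Strict Implicit.
Unset Printing Implicit Defensive.

Import Order.TTheory GRing.Theory Num.Theory.
Import numFieldNormedType.Exports.

Local Open Scope classical_set_scope.
Local Open Scope ring_scope.

Definition moment_curve (R : realType) (d : nat) : set 'rV[R]_d :=
  range (fun t : R => \row_(i < d) t ^+ i.+1).
Arguments moment_curve : clear implicits.

Definition convex_hull (R : realType) (d : nat) (A : set 'rV[R]_d) :
    set 'rV[R]_d :=
  smallest (@convex_set R 'rV[R]_d) A.

(* A set closed under the lines through any two of its points; over the reals
   these are exactly the affine subspaces (and the empty set). *)
Definition affine_set (R : realType) (d : nat) (A : set 'rV[R]_d) : Prop :=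
  forall (x y : 'rV[R]_d) (a : R), A x -> A y -> A (a *: x + (1 - a) *: y).

Definition affine_hull (R : realType) (d : nat) (A : set 'rV[R]_d) :
    set 'rV[R]_d :=
  smallest (@affine_set R d) A.

(* The interior of A in the topology induced on its affine hull. *)
Definition relative_interior (R : realType) (d : nat) (A : set 'rV[R]_d) :
    set 'rV[R]_d :=
  [set x | A x /\ \forall y \near x, affine_hull A y -> A y].

Definition hyperedges (d n : nat) : {set {set 'I_n}} :=
  [set e : {set 'I_n} | #|e| == d]%SET.

Definition simplex (R : realType) (d n : nat) (p : 'I_n -> 'rV[R]_d)
    (e : {set 'I_n}) : set 'rV[R]_d :=
  convex_hull (p @` [set` e]).

Definition crossing (R : realType) (d n : nat) (p : 'I_n -> 'rV[R]_d)
    (e f : {set 'I_n}) : Prop :=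
  (e :&: f = finset.set0)%SET /\
  relative_interior (simplex p e) `&` relative_interior (simplex p f) !=set0.

(* Unordered pairs, encoded as two-element sets {e, f} of hyperedges. *)
Definition crossing_pairs (R : realType) (d n : nat) (p : 'I_n -> 'rV[R]_d) :
    {set {set {set 'I_n}}} :=
  [set [set e; f] | e in hyperedges d n, f in hyperedges d n
    & `[< crossing p e f >]]%SET.

(* Main.v *)
Require Import Defs.
From HB Require Import structures.
From mathcomp Require Import all_boot all_order all_algebra.
From mathcomp Require Import all_classical all_reals all_analysis.
From mathcomp Require Import zify ring lra.
Import Order.TTheory GRing.Theory Num.Theory.
Import numFieldNormedType.Exports.
Local Open Scope classical_set_scope.
Local Open Scope ring_scope.

(** Every crossing pair {e, f} spans a set U = e :|: f of 2d vertices, so it is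
    enough to show that each of the 'C(n, 2d) sets U carries between
    'C(2d, d) / 20 and 'C(2d, d) crossing pairs, since 'C(2d, d) has the order
    of 4^d / sqrt d (central_bin_real_lb, central_bin_real_ub).  The upper
    bound is clear: e determines f = U :\: e.

    For the lower bound, list U along the curve and encode e by the word of
    length 2d that has true at the positions of e.  If this word changes its
    letter at least d + 1 times, then e and its complement in U cross.  Indeed,
    the affine dependences among the points of parameters t_0 < ... < t_(2d-1)
    on the curve are the weights c_j with sum_j c_j q(t_j) = 0 for all
    polynomials q of degree at most d, and a family of such weights is
    c_j = G(t_j) / prod_(i != j) (t_j - t_i) with G of degree at most d - 2.
    The signs of the denominators alternate, and G can be given one root between
    t_i and t_(i+1) for each of the at most d - 2 indices i where the word does
    not change: the signs of c_j then follow the word (alternating_dependence).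
    Moving the negative weights to the other side and normalizing gives one
    point that is a strictly positive convex combination of the vertices of e
    and also of those of U :\: e (alternating_simplices_meet).  Such a point is
    in the relative interior because barycentric coordinates are continuous;
    on the moment curve they are explicit, being the affine functionals
    attached to the Lagrange interpolation polynomials
    (relative_interior_moment_simplex).

    It remains to see that a positive proportion of the 'C(2d, d) words with d
    letters true have d + 1 changes.  There are exactly 'C(d, k)^2 such words
    with k descents, a descent being a true followed by a false
    (count_words_descents), and a word with k descents has at least 2k - 1
    changes.  As 'C(d, k)^2 is symmetric in k and sums to 'C(2d, d), the terms
    with 2k >= d + 2 amount to at least a tenth of the total
    (sum_bin_sqr_tail).  *)

Set Implicit Arguments.
Unset Strict Implicit.
Unset Printing Implicit Defensive.

(** * Descents and changes in words *)

Local Open Scope nat_scope.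

Fixpoint words (n : nat) : seq (seq bool) :=
  if n is m.+1 then map (cons true) (words m) ++ map (cons false) (words m)
  else [:: [::]].

(** The letter b is put in front of w, so that in particular changes false w
    also counts an initial true. *)
Fixpoint changes (b : bool) (w : seq bool) : nat :=
  if w is c :: w' then (b != c) + changes c w' else 0.

Fixpoint descents (b : bool) (w : seq bool) : nat :=
  if w is c :: w' then (b && ~~ c) + descents c w' else 0.

Lemma size_words n w : w \in words n -> size w = n.
Proof.
elim: n w => [|n IHn] w /=; first by rewrite inE => /eqP ->.
by rewrite mem_cat => /orP[] /mapP[v /IHn <- ->].
Qed.

Lemma words_uniq n : uniq (words n).
Proof.
elim: n => //= n IHn; rewrite cat_uniq !map_inj_uniq ?IHn /=; try by move=> ? ? [].
by rewrite andbT; apply/hasPn => _ /mapP[v _ ->]; apply/mapP => -[].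
Qed.

Lemma count_words_cons (P : pred (seq bool)) n :
  count P (words n.+1) =
  count (fun w => P (true :: w)) (words n) + count (fun w => P (false :: w)) (words n).
Proof. by rewrite /= count_cat !count_map. Qed.

(** Between two descents there is an ascent; the term b accounts for the ascent
    that is absent before the first descent when the word starts with true. *)
Lemma descents_changes b w : 2 * descents b w <= changes b w + b.
Proof.
elim: w b => [|c w IHw] b //=; have := IHw c.
by case: b; case: c => /=; lia.
Qed.

(** Each of the size w consecutive pairs of letters of c :: w is an agreement or a
    change. *)
Lemma agreements_changes c w :
  \sum_(i < size w) (nth false (c :: w) i == nth false (c :: w) i.+1) + changes c w
    = size w.
Proof.
elim: w c => [|b w IHw] c; first by rewrite big_ord0.
by rewrite big_ord_recl /= -[in RHS](IHw b) addnACA; case: b; case: c.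
Qed.

(** Removing the first letter relates the count for words that follow a false to
    the count for words that follow a true, so both closed formulas are proved
    together; each step is an instance of Pascal's rule. *)
Lemma count_words_descents n p q k : p + q = n ->
  count (fun w => (count id w == p) && (descents false w == k)) (words n)
    = 'C(p, k) * 'C(q, k) /\
  count (fun w => (count id w == p) && (descents true w == k)) (words n)
    = match q, k with
      | 0, 0 => 1
      | q'.+1, k'.+1 => 'C(p.+1, k) * 'C(q', k')
      | _, _ => 0
      end.
Proof.
elim: n p q k => [|n IHn] p q k.
  move=> /eqP; rewrite addn_eq0 => /andP[/eqP-> /eqP->].
  by case: k => [|k].
move=> pq; rewrite !count_words_cons /=.
(* A word of length n has neither more than n letters true nor, with one true in
   front, no letter true. *)
have full m : n < m -> forall P : pred (seq bool),
    count (fun w => (0 + count id w == m) && P w) (words n) = 0.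
  move=> nm P; apply/eqP; rewrite -leqn0 leqNgt -has_count; apply/hasPn => w.
  move/size_words => sw; rewrite negb_and; apply/orP; left.
  by rewrite ltn_eqF // (leq_ltn_trans (count_size _ _)) // sw.
have none (P : pred (seq bool)) :
    count (fun w => (1 + count id w == 0) && P w) (words n) = 0.
  by rewrite -[RHS](count_pred0 (words n)); apply: eq_count.
have shift m :
    count (fun w => (0 + count id w == m) && (1 + descents false w == 0)) (words n) = 0.
  rewrite -[RHS](count_pred0 (words n)); apply: eq_count => w /=.
  by rewrite andbF.
case: p pq => [|p] pq; case: q pq => [|q] pq //.
- rewrite !none !add0n /=.
  have E k0 := (IHn 0 q k0 ltac:(lia)).1.
  split; first by rewrite E !bin0n; case: k => [|k]; rewrite ?bin0.
  case: k => [|k]; first by rewrite shift.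
  by rewrite E binS (@bin_small 0 k.+1) // add0n.
- have np : n < p.+1 by lia.
  rewrite !(full _ np) !addn0.
  have [_ E] := IHn p 0 k ltac:(lia).
  by split; rewrite E; case: k {E} => //= k; rewrite bin0n ?muln0.
- have [_ E1] := IHn p q.+1 k ltac:(lia).
  have E2 j := (IHn p.+1 q j ltac:(lia)).1.
  rewrite E1 E2; split.
    by case: {E1} k => [|k]; rewrite ?bin0 // -mulnDr (binS q k) [in RHS]addnC.
  case: {E1} k => [|k]; first by rewrite shift.
  by rewrite E2 -mulnDl (binS p.+1 k).
Qed.

Lemma sum_count_eq (T : Type) (P : pred T) (f : T -> nat) k0 k1 s :
  \sum_(k0 <= k < k1) count (fun x => P x && (f x == k)) s
    = count (fun x => P x && (k0 <= f x < k1)) s.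
Proof.
elim: s => [|x s IHs] /=; first by rewrite big1_eq.
rewrite big_split /= IHs; congr (_ + _).
case: (P x) => /=; last by rewrite big1_eq.
have [fk|fk] := boolP (k0 <= f x < k1).
  rewrite (bigD1_seq (f x)) ?mem_index_iota ?iota_uniq //= eqxx big1 // => k.
  by rewrite eq_sym => /negbTE->.
rewrite big1_seq // => k; rewrite mem_index_iota => /andP[_ kk].
by case: eqP => // E; rewrite E kk in fk.
Qed.

(** * Central binomial coefficients *)

Lemma sum_bin_sqr d : \sum_(0 <= k < d.+1) 'C(d, k) ^ 2 = 'C(2 * d, d).
Proof.
rewrite mul2n -addnn -binomial.Vandermonde big_mkord; apply: eq_bigr => k _.
by rewrite bin_sub ?mulnn // -ltnS.
Qed.

(** By symmetry the terms with k < h, where h = d./2, have the same sum S as those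
    with k > d - h.  At most two terms remain in the middle; both equal
    'C(d, h)^2, and 'C(d, h) is at most twice its neighbour 'C(d, h - 1), so each
    of them is at most 4 S. *)
Lemma sum_bin_sqr_tail d : 4 <= d ->
  'C(2 * d, d) <= 10 * \sum_((d - d./2).+1 <= k < d.+1) 'C(d, k) ^ 2.
Proof.
move=> d4; set h := d./2; have dh := odd_double_half d; rewrite -/h in dh.
rewrite -sum_bin_sqr.
have h2 : 1 < h by lia.
rewrite (@big_cat_nat _ _ _ h) /=; [|lia|lia].
rewrite (@big_cat_nat _ _ _ (d - h).+1 h) /=; [|lia|lia].
set S := \sum_((d - h).+1 <= _ < _) _.
have -> : \sum_(0 <= k < h) 'C(d, k) ^ 2 = S.
  rewrite big_nat_rev /= /S -{1}(add0n (d - h).+1) big_addn.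
  have -> : d.+1 - (d - h).+1 = h by lia.
  apply: eq_big_nat => k kh; rewrite -[in RHS]bin_sub; last by lia.
  by congr ('C(_, _) ^ 2); lia.
have term : 'C(d, h) ^ 2 <= 4 * S.
  have first : 'C(d, h.-1) ^ 2 <= S.
    rewrite /S big_nat_recl; last by lia.
    rewrite -(@bin_sub d h.-1); last by lia.
    have -> : d - h.-1 = (d - h).+1 by lia.
    exact: leq_addr.
  have ratio : h * 'C(d, h) = (d - h.-1) * 'C(d, h.-1).
    by rewrite -{1 2}(prednK (ltnW h2)) mul_bin_left.
  have : 'C(d, h) <= 2 * 'C(d, h.-1).
    rewrite -(leq_pmul2l (ltnW h2)) ratio mulnA leq_mul2r.
    by apply/orP; right; lia.
  by rewrite -leq_sqr expnMn; lia.
have : \sum_(h <= k < (d - h).+1) 'C(d, k) ^ 2 <= 2 * 'C(d, h) ^ 2.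
  have [E|E] : (d - h = h \/ d - h = h.+1) by lia.
    by rewrite E big_nat1; lia.
  rewrite E big_nat_recl // big_nat1 -E bin_sub; lia.
lia.
Qed.

Lemma count_alternating_words d : 4 <= d ->
  'C(2 * d, d) <=
    10 * count (fun w => (count id w == d) && (d.+2 <= 2 * descents false w))
               (words (2 * d)).
Proof.
move=> d4; apply: leq_trans (sum_bin_sqr_tail d4) _; rewrite leq_mul2l /=.
rewrite (eq_bigr (fun k =>
  count (fun w => (count id w == d) && (descents false w == k)) (words (2 * d))));
  last first.
  move=> k _; rewrite (@count_words_descents _ d d k _).1 ?mulnn //.
  by rewrite mul2n addnn.
rewrite sum_count_eq; apply: sub_count => w /= /andP[-> /andP[kw _]] /=.
have := odd_double_half d; lia.
Qed.

Lemma central_bin_rec m : m.+1 * 'C(2 * m.+1, m.+1) = 2 * (2 * m).+1 * 'C(2 * m, m).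
Proof.
have -> : 2 * m.+1 = (2 * m).+2 by lia.
have E1 : (2 * m).+1 - m = m.+1 by lia.
rewrite -mul_bin_diag -[in LHS](@bin_sub (2 * m).+1 m) ?E1; last by lia.
rewrite -mulnA (mul_bin_diag (2 * m).+1 m) /= mulnA; congr (_ * _); lia.
Qed.

(** With the factor 2m + 1 the left side divided by 16^m decreases in m, and the
    bound propagates by induction.  With a factor proportional to m, as in the
    lower bound central_bin_lb, this quotient increases. *)
Lemma central_bin_ub m : (2 * m).+1 * 'C(2 * m, m) ^ 2 <= 16 ^ m.
Proof.
elim: m => // m IHm.
rewrite (expnS 16) -(leq_pmul2l (isT : 0 < m.+1 ^ 2)) [leqLHS]mulnCA -expnMn central_bin_rec.
rewrite !expnMn.
move: ('C(_, _) ^ 2) (16 ^ _) IHm => x y IHm.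
have -> : (2 * m.+1).+1 * (2 ^ 2 * (2 * m).+1 ^ 2 * x)
    = (4 * (2 * m).+1 * (2 * m.+1).+1) * ((2 * m).+1 * x) by nia.
rewrite [leqRHS]mulnA leq_mul // -mulnn; nia.
Qed.

Lemma central_bin_lb m : 0 < m -> 16 ^ m <= 4 * m * 'C(2 * m, m) ^ 2.
Proof.
case: m => // m _; elim: m => // m IHm.
rewrite (expnS 16) -(leq_pmul2l (isT : 0 < m.+2 ^ 2)) [leqRHS]mulnCA -expnMn central_bin_rec.
rewrite !expnMn.
move: ('C(_, _) ^ 2) (16 ^ _) IHm => x y IHm.
have -> : 4 * m.+2 * (2 ^ 2 * (2 * m.+1).+1 ^ 2 * x)
    = (4 * m.+2 * (2 * m.+1).+1 ^ 2) * (4 * x) by rewrite -mulnn; nia.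
have ratio : 16 * m.+2 ^ 2 * m.+1 <= 4 * m.+2 * (2 * m.+1).+1 ^ 2.
  rewrite -!mulnn; nia.
apply: leq_trans (_ : 16 * m.+2 ^ 2 * (4 * m.+1 * x) <= _).
  by rewrite mulnCA mulnA leq_mul.
rewrite [leqLHS](_ : _ = (16 * m.+2 ^ 2 * m.+1) * (4 * x)); last by lia.
by rewrite leq_mul.
Qed.

Local Open Scope ring_scope.

(** * Affine dependences with prescribed signs *)

(** The sum is the coefficient of degree M in the Lagrange interpolation of q at
    M + 1 points, and this interpolation is q itself. *)
Lemma sum_divided_difference (F : fieldType) (M : nat) (t : 'I_M.+1 -> F) (q : {poly F}) :
  injective t -> (size q <= M)%N ->
  \sum_j q.[t j] / \prod_(i < M) (t j - t (lift j i)) = 0.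
Proof.
move=> t_inj sq.
pose L (j : 'I_M.+1) := \prod_(i < M) ('X - (t (lift j i))%:P).
pose c (j : 'I_M.+1) := q.[t j] / \prod_(i < M) (t j - t (lift j i)).
have L_size j : size (L j) = M.+1.
  by rewrite /L size_prod_XsubC /index_enum -enumT size_enum_ord.
have interp : \sum_j c j *: L j = q.
  apply/eqP; rewrite -subr_eq0; apply/eqP.
  apply: (@roots_geq_poly_eq0 _ _ (map t (enum 'I_M.+1))).
  - apply/allP => _ /mapP[k _ ->]; rewrite rootE !hornerE horner_sum subr_eq0.
    rewrite (bigD1 k) //= [X in _ + X]big1 => [|j jk].
      rewrite addr0 hornerZ horner_prod /c.
      under [X in _ * X]eq_bigr => i _ do rewrite hornerXsubC.
      rewrite divfK //; apply/prodf_neq0 => i _.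
      by rewrite subr_eq0 (inj_eq t_inj) neq_lift.
    have [i ki|kj] := unliftP j k; last by rewrite kj eqxx in jk.
    by rewrite hornerZ horner_prod (bigD1 i) //= hornerXsubC -ki subrr mul0r mulr0.
  - by rewrite map_inj_uniq ?enum_uniq.
  rewrite size_map size_enum_ord (leq_trans (size_polyD _ _)) // geq_max.
  rewrite size_polyN (leqW sq) andbT.
  apply: (leq_trans (size_sum _ _ _)); apply/bigmax_leqP => j _.
  by rewrite (leq_trans (size_scale_leq _ _)) ?L_size.
have := congr1 (fun p : {poly F} => p`_M) interp.
rewrite coef_sum [RHS]nth_default // => E; rewrite -[RHS]E; apply: eq_bigr => j _.
have : L j \is monic by apply: monic_prod_XsubC.
by rewrite coefZ => /monicP; rewrite lead_coefE L_size /= => ->; rewrite mulr1.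
Qed.

Lemma signr_telescope (R : pzRingType) (w : nat -> bool) (j M : nat) : (j <= M)%N ->
  (-1) ^+ w j * (-1) ^+ w M = \prod_(j <= i < M) (-1) ^+ (w i (+) w i.+1) :> R.
Proof.
elim: M => [|M IHM]; first by rewrite leqn0 => /eqP->; rewrite -signr_addb addbb big_geq.
rewrite leq_eqVlt => /orP[/eqP->|jM]; first by rewrite -signr_addb addbb big_geq.
rewrite big_nat_recr //= -IHM // -mulrA -!signr_addb; congr (_ ^+ nat_of_bool _).
by rewrite addKb.
Qed.

(** The weights are those described at the top of the file, up to the global sign
    (-1) ^+ w M.  To read their sign at j, the factor of index i of the
    denominator is paired with the root of G in the interval from t i to t i.+1 if
    there is one, and with the change of letter between i and i.+1 otherwise: each
    quotient so obtained is positive. *)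
Lemma alternating_dependence (R : realFieldType) (M d : nat) (t : nat -> R) (w : nat -> bool) :
  (forall i j, (i < j)%N -> (j <= M)%N -> t i < t j) ->
  (\sum_(i < M) (w i == w i.+1) + d < M)%N ->
  exists c : nat -> R,
    (forall j, (j <= M)%N -> 0 < (-1) ^+ w j * c j) /\
    forall q : {poly R}, (size q <= d.+1)%N -> \sum_(j < M.+1) c j * q.[t j] = 0.
Proof.
move=> t_mono few.
have t_le i j : (i <= j)%N -> (j <= M)%N -> t i <= t j.
  by rewrite leq_eqVlt => /orP[/eqP->//|ij] jM; apply/ltW/t_mono.
pose m i := (t i + t i.+1) / 2.
pose G := \prod_(i < M | w i == w i.+1) ('X - (m i)%:P).
exists (fun j => (-1) ^+ w M * (G.[t j] / \prod_(i < M) (t j - t (bump j i)))); split.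
  move=> j jM; rewrite mulrA signr_telescope // big_geq_mkord /= big_mkcond /=.
  rewrite /G horner_prod [X in X / _]big_mkcond -prodf_div /= -big_split /=.
  apply: prodr_gt0 => i _; rewrite /bump; have iM := ltn_ord i.
  have mi : t i < m i < t i.+1.
    by have := t_mono i i.+1 (leqnn _) iM; rewrite /m; lra.
  case: leqP => ij; rewrite ?add1n ?add0n; case: eqP => [ww|ww]; rewrite ?hornerXsubC.
  - have tj := t_le j i ij (ltnW iM).
    rewrite ww addbb mul1r -mulrNN -invrN divr_gt0 //; lra.
  - have tj := t_le j i ij (ltnW iM).
    rewrite (_ : _ (+) _ = true); last by case: (w i) (w i.+1) ww => [] [].
    rewrite expr1 mul1r mulN1r -invrN invr_gt0; lra.
  - by have tj := t_le i.+1 j ij jM; rewrite mul1r divr_gt0 //; lra.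
  - by have tj := t_le i.+1 j ij jM; rewrite !mul1r invr_gt0; lra.
move=> q sq; rewrite -[RHS](mulr0 ((-1) ^+ w M)).
rewrite -[in RHS](@sum_divided_difference _ M (fun j => t j) (G * q)).
- rewrite mulr_sumr; apply: eq_bigr => j _; rewrite hornerM; ring.
- move=> i j /eqP tij; apply/val_inj/eqP; case: ltngtP => //= ij.
    by have := t_mono _ _ ij (ltn_ord j); rewrite (eqP tij) ltxx.
  by have := t_mono _ _ ij (ltn_ord i); rewrite (eqP tij) ltxx.
apply: leq_trans (size_polyMleq _ _) _.
have -> : size G = (\sum_(i < M) (w i == w i.+1)).+1.
  rewrite /G -big_filter size_prod_XsubC; congr _.+1.
  by rewrite size_filter -sum1_count big_mkcond.
by rewrite addSn /=; apply: leq_trans few; rewrite -addnS leq_add2l.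
Qed.

(** * Relative interiors of simplices on the moment curve *)

Lemma convex_set_sum (R : realType) (V : lmodType R) (I : Type) (A : set V)
    (r : seq I) (P : pred I) (c : I -> R) (v : I -> V) :
  @convex_set R V A -> has P r ->
  (forall i, P i -> 0 < c i) -> (forall i, P i -> A (v i)) ->
  A ((\sum_(i <- r | P i) c i)^-1 *: \sum_(i <- r | P i) c i *: v i).
Proof.
move=> A_convex + c_gt0 vA.
suff main : has P r -> 0 < \sum_(i <- r | P i) c i /\
    A ((\sum_(i <- r | P i) c i)^-1 *: \sum_(i <- r | P i) c i *: v i).
  by move=> /main[].
elim: r => //= i r IHr; rewrite !big_cons; case: ifP => [Pi _|_ /=]; last exact: IHr.
have ci := c_gt0 i Pi.
have [/IHr[S_gt0 Ar]|rP] := boolP (has P r); last first.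
  by rewrite !big_hasC // !addr0 scalerA mulVf ?scale1r ?gt_eqF //; split=> //; apply: vA.
move: Ar S_gt0; set S := \sum_(_ <- _ | _) c _; set x := \sum_(_ <- _ | _) _ *: _.
move=> Ax S_gt0; have cS : 0 < c i + S by rewrite addr_gt0.
split=> //.
have l_ge0 : 0 <= c i / (c i + S) by rewrite divr_ge0 ?ltW.
have l_le1 : c i / (c i + S) <= 1 by rewrite ler_pdivrMr // mul1r lerDl ltW.
have := A_convex (v i) (S^-1 *: x) (Itv01 l_ge0 l_le1) (mem_set (vA i Pi)) (mem_set Ax).
rewrite inE; congr A.
rewrite /conv /= scalerDr !scalerA [(c i + S)^-1 * _]mulrC; congr (_ + _ *: _).
by rewrite /unstable.onem; field; rewrite !gt_eqF.
Qed.

Definition moment_point (R : realType) (d : nat) (t : R) : 'rV[R]_d :=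
  \row_(k < d) t ^+ k.+1.

(** The affine functional that takes the value q.[t] at the point of parameter t
    of the moment curve, for q of degree at most d. *)
Definition affine_eval (R : realType) (d : nat) (q : {poly R}) (y : 'rV[R]_d) : R :=
  q`_0 + \sum_(k < d) q`_k.+1 * y 0 k.

Lemma affine_eval_moment_point (R : realType) d (q : {poly R}) t :
  (size q <= d.+1)%N -> affine_eval q (moment_point d t) = q.[t].
Proof.
move=> sq; rewrite (horner_coef_wide _ sq) big_ord_recl /= expr0 mulr1.
by congr (_ + _); apply: eq_bigr => k _; rewrite mxE.
Qed.

Lemma affine_eval_comb (R : realType) d (q : {poly R}) (x y : 'rV[R]_d) a :
  affine_eval q (a *: x + (1 - a) *: y) =
  a * affine_eval q x + (1 - a) * affine_eval q y.
Proof.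
rewrite /affine_eval.
under eq_bigr => k _ do rewrite !mxE mulrDr !(mulrCA q`_k.+1).
by rewrite big_split /= -!mulr_sumr; ring.
Qed.

Lemma affine_eval_sum (R : realType) d (q : {poly R}) (I : finType) (P : pred I)
    (c : I -> R) (v : I -> 'rV[R]_d) :
  \sum_(i | P i) c i = 1 ->
  affine_eval q (\sum_(i | P i) c i *: v i) = \sum_(i | P i) c i * affine_eval q (v i).
Proof.
move=> c1; rewrite /affine_eval.
under [RHS]eq_bigr => i _ do rewrite mulrDr mulr_sumr.
rewrite big_split /= -mulr_suml c1 mul1r exchange_big /=; congr (_ + _).
apply: eq_bigr => k _; rewrite summxE mulr_sumr; apply: eq_bigr => i _.
by rewrite mxE mulrCA.
Qed.

Lemma affine_eval_continuous (R : realType) d (q : {poly R}) :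
  continuous (@affine_eval R d q).
Proof.
move=> y.
pose g := (fun z : 'rV[R]_d => \sum_(k < d) q`_k.+1 * z 0 k) : 'rV[R]_d -> R^o.
change ({for y, continuous (cst (q`_0 : R^o) + g)}).
apply: continuousD; first exact: cst_continuous.
apply: (@continuous_big R^o _ +%R 0 xpredT add_continuous) => k _ z.
apply: cvgMl_tmp; [exact: nbhs_filter|exact: (@coord_continuous R 1 d 0 k z)].
Qed.

(** The functionals affine_eval (L i), for the Lagrange polynomials L i of the
    vertices, are barycentric coordinates: they reconstruct every point of the
    affine hull of the simplex.  They are positive at the given point, hence near
    it by continuity, and where they are positive a point of the affine hull is a
    convex combination of the vertices. *)
Lemma relative_interior_moment_simplex (R : realType) (d : nat) (I : finType)
    (A : {set I}) (t : I -> R) (c : I -> R) :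
  injective t -> (#|A| <= d.+1)%N ->
  (forall i, i \in A -> 0 < c i) -> \sum_(i in A) c i = 1 ->
  relative_interior (convex_hull ((fun i => moment_point d (t i)) @` [set` A]))
    (\sum_(i in A) c i *: moment_point d (t i)).
Proof.
move=> t_inj cA c_gt0 c1.
have [i0 i0A] : exists i, i \in A.
  have [A0|[i iA]] := finset.set_0Vmem A; last by exists i.
  by move/eqP: c1; rewrite A0 finset.big_set0 eq_sym oner_eq0.
pose v i := moment_point d (t i); rewrite -/v.
pose L i : {poly R} :=
  (\prod_(j in A :\ i) (t i - t j))^-1 *: \prod_(j in A :\ i) ('X - (t j)%:P).
have L_size i : i \in A -> (size (L i) <= d.+1)%N.
  move=> iA; apply: leq_trans cA; apply: leq_trans (size_scale_leq _ _) _.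
  by rewrite -big_enum size_prod_XsubC -cardE [leqRHS](cardsD1 i A) iA.
have L_root i j : i \in A -> j \in A -> affine_eval (L i) (v j) = (i == j)%:R.
  move=> iA jA; rewrite affine_eval_moment_point ?L_size // hornerZ horner_prod.
  under [X in _ * X]eq_bigr => k _ do rewrite hornerXsubC.
  have [<-|ij] := eqVneq.
    rewrite mulVf //; apply/prodf_neq0 => k; rewrite !inE => /andP[ki _].
    by rewrite subr_eq0 (inj_eq t_inj) eq_sym.
  by rewrite [X in _ * X](bigD1 j) ?inE ?jA 1?eq_sym ?ij //= subrr mul0r mulr0.
have hull : affine_hull (convex_hull (v @` [set` A])) `<=`
    [set y | \sum_(i in A) affine_eval (L i) y = 1 /\
             y = \sum_(i in A) affine_eval (L i) y *: v i].
  apply: smallest_sub;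
    [move=> x y a [x1 xE] [y1 yE] /= | rewrite /convex_hull; apply: smallest_sub].
  - split.
      under eq_bigr do rewrite affine_eval_comb.
      by rewrite big_split /= -!mulr_sumr x1 y1; ring.
    under eq_bigr do rewrite affine_eval_comb scalerDl -!scalerA.
    by rewrite big_split /= -!scaler_sumr -xE -yE.
  - move=> x y l; rewrite !inE => -[x1 xE] [y1 yE] /=.
    have E i : affine_eval (L i) (conv l x y) =
        l%:num * affine_eval (L i) x + (1 - l%:num) * affine_eval (L i) y.
      exact: affine_eval_comb.
    split.
      under eq_bigr do rewrite E.
      by rewrite big_split /= -!mulr_sumr x1 y1; ring.
    under eq_bigr do rewrite E scalerDl -!scalerA.
    by rewrite big_split /= -!scaler_sumr -xE -yE.
  move=> _ [i iA <-] /=; split.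
    rewrite (bigD1 i) //= L_root // eqxx big1 ?addr0 // => j /andP[jA ji].
    by rewrite L_root // (negbTE ji).
  rewrite (bigD1 i) //= L_root // eqxx scale1r big1 ?addr0 // => j /andP[jA ji].
  by rewrite L_root // (negbTE ji) scale0r.
have in_hull (y : 'rV[R]_d) : (forall i, i \in A -> 0 < affine_eval (L i) y) ->
    \sum_(i in A) affine_eval (L i) y = 1 ->
    convex_hull (v @` [set` A]) (\sum_(i in A) affine_eval (L i) y *: v i).
  move=> pos y1 B [B_convex vB].
  have hA : has (mem A) (index_enum I).
    by apply/hasP; exists i0; rewrite ?mem_index_enum.
  have := @convex_set_sum R _ I B (index_enum I) (mem A) _ v B_convex hA pos.
  rewrite y1 invr1 scale1r; apply=> i iA; apply: vB; by exists i.
have xE i : i \in A -> affine_eval (L i) (\sum_(i in A) c i *: v i) = c i.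
  move=> iA; rewrite affine_eval_sum // (bigD1 i) //= L_root // eqxx mulr1.
  rewrite big1 ?addr0 // => j /andP[jA ji].
  by rewrite L_root // eq_sym (negbTE ji) mulr0.
have xcomb : \sum_(i in A) affine_eval (L i) (\sum_(i in A) c i *: v i) *: v i
    = \sum_(i in A) c i *: v i.
  by apply: eq_bigr => i iA; rewrite xE.
split.
  rewrite -[X in convex_hull _ X]xcomb; apply: in_hull => [i iA|].
    by rewrite xE ?c_gt0.
  by rewrite -[RHS]c1; apply: eq_bigr => i iA; rewrite xE.
have pos_near : \forall y \near (\sum_(i in A) c i *: v i : 'rV[R]_d),
    forall i, i \in A -> 0 < affine_eval (L i) y.
  pose pos i := [set y : 'rV[R]_d | i \in A -> 0 < affine_eval (L i) y].
  apply: (@filter_forall _ _ pos _ (nbhs_filter _)) => i.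
  have [iA|iA] := boolP (i \in A); last first.
    by apply: filterS filterT => y _; rewrite /pos /= (negbTE iA).
  have := c_gt0 i iA; rewrite -xE // => pos_x.
  have near_x : \forall y \near (\sum_(i in A) c i *: v i : 'rV[R]_d),
      0 < affine_eval (L i) y.
    exact: cvgr_gt _ (@affine_eval_continuous R d (L i) _) _ pos_x.
  by apply: (filterS _ near_x) => y y_pos _.
by apply: (filterS _ pos_near) => y y_pos /hull[y1 ->]; apply: in_hull.
Qed.

(** The alternating dependence, applied to the monomials, is an affine dependence
    between the points; its two parts of constant sign, normalized, are the same
    point written in each of the two simplices. *)
Lemma alternating_simplices_meet (R : realType) (d M : nat) (t : nat -> R) (w : nat -> bool) :
  (forall i j, (i < j)%N -> (j <= M)%N -> t i < t j) ->
  (\sum_(i < M) (w i == w i.+1) + d < M)%N ->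
  (0 < #|[set j : 'I_M.+1 | w j]%SET| <= d.+1)%N ->
  (#|[set j : 'I_M.+1 | ~~ w j]%SET| <= d.+1)%N ->
  let v (j : 'I_M.+1) := moment_point d (t j) in
  relative_interior (convex_hull (v @` [set` [set j : 'I_M.+1 | w j]%SET])) `&`
  relative_interior (convex_hull (v @` [set` [set j : 'I_M.+1 | ~~ w j]%SET])) !=set0.
Proof.
move=> t_mono few /andP[/card_gt0P[j0 wj0] cA] cB v; rewrite inE in wj0.
have [b [b_sign b_dep]] := alternating_dependence t_mono few.
(* The weights b are negative where w is true. *)
pose c j := - b j.
pose s := \sum_(j < M.+1 | w j) c j.
have t_inj : injective (fun j : 'I_M.+1 => t j).
  move=> i j tij; apply/val_inj/eqP; case: ltngtP => //= ij.
    by have := t_mono _ _ ij (ltn_ord j); rewrite tij ltxx.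
  by have := t_mono _ _ ij (ltn_ord i); rewrite tij ltxx.
have c_pos (j : 'I_M.+1) : w j -> 0 < c j.
  by move=> wj; have := b_sign j (ltn_ord j); rewrite wj expr1 /c; lra.
have c_neg (j : 'I_M.+1) : ~~ w j -> 0 < - c j.
  by move=> /negbTE wj; have := b_sign j (ltn_ord j); rewrite wj expr0 /c; lra.
have s_gt0 : 0 < s.
  rewrite /s (bigD1 j0) //= ltr_wpDr ?c_pos //.
  by apply: sumr_ge0 => j /andP[wj _]; rewrite ltW ?c_pos.
have split_dep (q : {poly R}) : (size q <= d.+1)%N ->
    \sum_(j < M.+1 | w j) c j * q.[t j] = \sum_(j < M.+1 | ~~ w j) - c j * q.[t j].
  move=> /b_dep/eqP; rewrite -oppr_eq0 -sumrN.
  under eq_bigr => j _ do rewrite -mulNr.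
  rewrite (bigID (fun j : 'I_M.+1 => w j)) /= addr_eq0 => /eqP ->.
  rewrite -sumrN; apply: eq_bigr => j _.
  by rewrite -mulNr.
(* The constant polynomial: both parts have the same total weight. *)
have sE : s = \sum_(j < M.+1 | ~~ w j) - c j.
  transitivity (\sum_(j < M.+1 | w j) c j * (1%:P).[t j]).
    by apply: eq_bigr => j _; rewrite hornerC mulr1.
  rewrite split_dep ?size_polyC ?oner_eq0 //.
  by apply: eq_bigr => j _; rewrite hornerC mulr1.
have pos_part : \sum_(j < M.+1 | w j) c j / s = 1.
  by rewrite -mulr_suml divff ?gt_eqF.
have neg_part : \sum_(j < M.+1 | ~~ w j) - c j / s = 1.
  by rewrite -mulr_suml -sE divff ?gt_eqF.
have eq_big_in (V : nmodType) (Q : pred 'I_M.+1) (F : 'I_M.+1 -> V) :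
    \sum_(j in [set j | Q j]%SET) F j = \sum_(j | Q j) F j.
  by apply: eq_bigl => j; rewrite inE.
exists (\sum_(j < M.+1 | w j) (c j / s) *: v j); split.
  have := @relative_interior_moment_simplex R d _ [set j : 'I_M.+1 | w j]%SET
    (fun j => t j) (fun j => c j / s) t_inj cA.
  rewrite !eq_big_in; apply=> // j; rewrite inE => wj.
  by rewrite divr_gt0 ?c_pos.
have -> : \sum_(j < M.+1 | w j) (c j / s) *: v j
    = \sum_(j < M.+1 | ~~ w j) (- c j / s) *: v j.
  apply/rowP => k; rewrite !summxE.
  transitivity (s^-1 * \sum_(j < M.+1 | w j) c j * ('X^(k.+1)).[t j]).
    by rewrite mulr_sumr; apply: eq_bigr => j _; rewrite !mxE hornerXn mulrCA mulrA.
  rewrite split_dep ?size_polyXn ?ltnS // mulr_sumr; apply: eq_bigr => j _.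
  by rewrite !mxE hornerXn mulrCA mulrA.
have := @relative_interior_moment_simplex R d _ [set j : 'I_M.+1 | ~~ w j]%SET
  (fun j => t j) (fun j => - c j / s) t_inj cB.
rewrite !eq_big_in; apply=> // j; rewrite inE => wj.
by rewrite divr_gt0 ?c_neg.
Qed.

(** * Words and hyperedges *)

Definition sorted_by (R : realType) (n : nat) (t : 'I_n -> R) (U : {set 'I_n}) : seq 'I_n :=
  sort (relpre t <=%R) (enum U).

Definition word_edge (R : realType) (n : nat) (t : 'I_n -> R) (U : {set 'I_n})
    (w : seq bool) : {set 'I_n} :=
  [set x in mask w (sorted_by t U)]%SET.

Section SortedBy.
Variables (R : realType) (n : nat) (t : 'I_n -> R) (U : {set 'I_n}).
Implicit Types (w : seq bool) (x : 'I_n).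

Lemma mem_sorted_by x : (x \in sorted_by t U) = (x \in U).
Proof. by rewrite mem_sort mem_enum. Qed.

Lemma size_sorted_by : size (sorted_by t U) = #|U|.
Proof. by rewrite size_sort -cardE. Qed.

Lemma sorted_by_uniq : uniq (sorted_by t U).
Proof. by rewrite sort_uniq enum_uniq. Qed.

Lemma sorted_by_lt x0 i j : injective t -> (i < j)%N -> (j < #|U|)%N ->
  t (nth x0 (sorted_by t U) i) < t (nth x0 (sorted_by t U) j).
Proof.
move=> t_inj ij jU; have iU := ltn_trans ij jU; rewrite lt_neqAle; apply/andP; split.
  by rewrite (inj_eq t_inj) nth_uniq ?size_sorted_by ?sorted_by_uniq // ltn_eqF.
have le_trans : transitive (relpre t <=%R) by move=> y x z; apply: le_trans.
have sorted_s : sorted (relpre t <=%R) (sorted_by t U).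
  by apply: sort_sorted => x y /=; apply: le_total.
by apply: (sorted_ltn_nth le_trans x0 sorted_s) => //; rewrite inE size_sorted_by.
Qed.

Lemma word_edge_sub w : word_edge t U w \subset U.
Proof. by apply/fintype.subsetP => x; rewrite inE => /mem_mask; rewrite mem_sorted_by. Qed.

Lemma mem_word_edge w x :
  (x \in word_edge t U w) = (x \in U) && nth false w (index x (sorted_by t U)).
Proof. by rewrite inE in_mask ?sorted_by_uniq // mem_sorted_by. Qed.

Lemma card_word_edge w : size w = #|U| -> #|word_edge t U w| = count id w.
Proof.
move=> sw; rewrite cardsE; have /card_uniqP-> := mask_uniq (sorted_by_uniq) w.
by rewrite size_mask // size_sorted_by.
Qed.

Lemma word_edge_inj : {in [pred w | size w == #|U|] &, injective (word_edge t U)}.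
Proof.
move=> w w'; rewrite !inE => /eqP sw /eqP sw' eq_ww'.
apply: (@eq_from_nth _ false) => [|i]; first by rewrite sw.
rewrite sw => iU.
have /card_gt0P[x0 _] : (0 < #|U|)%N by apply: leq_ltn_trans iU.
have := congr1 (fun e : {set 'I_n} => nth x0 (sorted_by t U) i \in e) eq_ww'.
rewrite /= !mem_word_edge index_uniq ?size_sorted_by ?sorted_by_uniq //.
by rewrite -mem_sorted_by mem_nth ?size_sorted_by.
Qed.

End SortedBy.

(** With k descents, 2k >= d + 2, the word has at least d + 1 changes, hence at most
    d - 2 agreements among its 2d - 1 pairs of consecutive letters, which is what
    the meeting of the two simplices requires. *)
Lemma crossing_word_edge (R : realType) (d n : nat) (p : 'I_n -> 'rV[R]_d) (t : 'I_n -> R)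
    (U : {set 'I_n}) (w : seq bool) :
  injective t -> (forall i, p i = moment_point d (t i)) ->
  #|U| = (2 * d)%N -> size w = (2 * d)%N -> count id w = d ->
  (d.+2 <= 2 * descents false w)%N ->
  crossing p (word_edge t U w) (U :\: word_edge t U w).
Proof.
move=> t_inj pE cU sw cw dw; set e := word_edge t U w.
have ce : #|e| = d by rewrite card_word_edge ?sw.
have cUe : #|U :\: e| = d by rewrite cardsDS ?word_edge_sub // cU ce; lia.
split.
  apply/finset.setP => x; rewrite finset.in_setI finset.in_setD finset.in_set0.
  by case: (x \in e).
have d_gt0 : (0 < d)%N.
  by case: (posnP d) => // d0; move: dw; rewrite (@size0nil _ w) // sw d0.
have [x0 x0e] : exists x0, x0 \in e by apply/card_gt0P; rewrite ce.
have [M ME] : exists M, (2 * d)%N = M.+1 by exists (2 * d).-1; lia.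
pose s := sorted_by t U; pose u j := t (nth x0 s j).
have nth_index_s x : x \in U -> nth x0 s (index x s) = x.
  by move=> xU; rewrite nth_index // mem_sorted_by.
have index_lt x : x \in U -> (index x s < M.+1)%N.
  by move=> xU; rewrite -ME -cU -(size_sorted_by t) index_mem mem_sorted_by.
(* Vertex sets are transported from subsets of U to subsets of the positions in
   the sorted list, the index type of alternating_simplices_meet. *)
have simplexE (Q : pred nat) (f : {set 'I_n}) :
    (forall x, (x \in f) = (x \in U) && Q (index x s)) ->
    p @` [set` f] = (fun j : 'I_M.+1 => moment_point d (u j)) @`
                      [set` [set j : 'I_M.+1 | Q j]%SET] /\
    #|[set j : 'I_M.+1 | Q j]%SET| = #|f|.
  move=> fE; have s_in (j : 'I_M.+1) : nth x0 s j \in U.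
    by rewrite -(mem_sorted_by t) mem_nth // size_sorted_by cU ME.
  have s_index (j : 'I_M.+1) : index (nth x0 s j) s = j.
    by rewrite index_uniq ?sorted_by_uniq // size_sorted_by cU ME.
  split.
    apply/seteqP; split=> [_ [x xf <-]|_ [j jQ <-]].
      move: xf; rewrite /= fE => /andP[xU Qx].
      exists (Ordinal (index_lt x xU)); first by rewrite /= inE.
      by rewrite /u /= nth_index_s // pE.
    exists (nth x0 s j); last by rewrite pE.
    by move: jQ; rewrite /= inE fE s_in s_index.
  rewrite -(card_imset _ (_ : injective (fun j : 'I_M.+1 => nth x0 s j))).
    apply: eq_card => x; apply/imsetP/idP => [[j jQ ->]|].
      by move: jQ; rewrite inE fE s_in s_index.
    rewrite fE => /andP[xU Qx].
    by exists (Ordinal (index_lt x xU)); rewrite ?inE /= ?nth_index_s.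
  by move=> i j /(congr1 (index^~ s)); rewrite !s_index => /val_inj.
have [|eE ecard] := simplexE (nth false w) e; first exact: mem_word_edge.
have [|fE fcard] := simplexE (fun i => ~~ nth false w i) (U :\: e).
  by move=> x; rewrite finset.in_setD mem_word_edge; case: (x \in U); rewrite ?andbF ?andbT.
rewrite /simplex eE fE; apply: alternating_simplices_meet.
- by move=> i j ij jM; apply: sorted_by_lt; rewrite // cU ME.
- case: w sw {cw e ce cUe x0e eE ecard fE fcard} dw => [|b w] /=; first by rewrite ME.
  move=> sw dw; have := descents_changes false (b :: w); have := agreements_changes b w.
  have -> : size w = M by lia.
  move: dw => /=; move: (\sum_(i < M) _)%N => A; case: b {sw} => /=; lia.
- by rewrite ecard ce; apply/andP; split; [lia|].
by rewrite fcard cUe.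
Qed.

(** * Counting crossing pairs *)

Section CrossingPairs.
Variables (R : realType) (d n : nat) (p : 'I_n -> 'rV[R]_d).

Definition crossing_pairs_on (U : {set 'I_n}) : {set {set {set 'I_n}}} :=
  [set P in crossing_pairs p | finset.cover P == U]%SET.

Lemma cover_pair (e f : {set 'I_n}) : finset.cover [set e; f]%SET = (e :|: f)%SET.
Proof.
apply/finset.setP => x; rewrite finset.in_setU; apply/bigcupP/orP.
  by case=> g; rewrite !inE => /orP[]/eqP-> xg; [left|right].
by case=> xg; [exists e|exists f]; rewrite // !inE eqxx ?orbT.
Qed.

Lemma crossing_pairsP (P : {set {set 'I_n}}) : P \in crossing_pairs p ->
  exists e f : {set 'I_n},
    [/\ P = [set e; f]%SET, #|e| = d, #|f| = d & (e :&: f = finset.set0)%SET].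
Proof.
case/imset2P => e f; rewrite !inE => /eqP ce /andP[/eqP cf /asboolP[ef _]] ->.
by exists e, f.
Qed.

Lemma card_crossing_pairs :
  #|crossing_pairs p| = (\sum_(U : {set 'I_n} | #|U| == (2 * d)%N) #|crossing_pairs_on U|)%N.
Proof.
rewrite -sum1_card.
rewrite (partition_big (@finset.cover _) (fun U : {set 'I_n} => #|U| == (2 * d)%N)) /=.
  apply: eq_bigr => U _; rewrite -sum1_card; apply: eq_bigl => P.
  by rewrite inE.
move=> _ /crossing_pairsP[e [f [-> ce cf ef]]].
by rewrite cover_pair cardsU ef cards0 subn0 ce cf mul2n addnn.
Qed.

Lemma card_crossing_pairs_on_ub (U : {set 'I_n}) : #|U| = (2 * d)%N ->
  (#|crossing_pairs_on U| <= 'C(2 * d, d))%N.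
Proof.
move=> cU; rewrite -cU -cards_draws.
apply: leq_trans (leq_imset_card (fun e : {set 'I_n} => [set e; U :\: e]%SET) _).
apply/subset_leq_card/fintype.subsetP => P; rewrite inE => /andP[/crossing_pairsP].
case=> e [f [-> ce cf ef]]; rewrite cover_pair => /eqP eU.
apply/imsetP; exists e; first by rewrite inE -eU finset.subsetUl ce eqxx.
have fe : (f :\: e = f)%SET.
  by apply/finset.setDidPl; rewrite disjoint_sym -finset.setI_eq0 ef.
by rewrite -eU finset.setDUl finset.setDv finset.set0U fe.
Qed.

(** A crossing pair consists of two hyperedges, so it accounts for at most two of
    the words that describe crossing hyperedges: the number of pairs is at least
    half of the number of words. *)
Lemma card_crossing_pairs_on_lb (t : 'I_n -> R) (U : {set 'I_n}) :
  injective t -> (forall i, p i = moment_point d (t i)) -> (4 <= d)%N -> #|U| = (2 * d)%N ->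
  ('C(2 * d, d) <= 20 * #|crossing_pairs_on U|)%N.
Proof.
move=> t_inj pE d4 cU.
pose good := fun w => (count id w == d) && (d.+2 <= 2 * descents false w)%N.
pose edges := map (word_edge t U) [seq w <- words (2 * d) | good w].
apply: leq_trans (count_alternating_words d4) _.
rewrite -/good (_ : 20 = 10 * 2)%N // -mulnA leq_mul2l /=.
have edges_uniq : uniq edges.
  rewrite map_inj_in_uniq ?filter_uniq ?words_uniq // => w w'.
  rewrite !mem_filter => /andP[_ /size_words sw] /andP[_ /size_words sw'].
  by apply: word_edge_inj; rewrite inE cU ?sw ?sw'.
rewrite -size_filter -(size_map (word_edge t U)) -/edges -(card_uniqP edges_uniq).
apply: leq_trans (_ : #|finset.cover (crossing_pairs_on U)| <= _)%N.
  apply/subset_leq_card/fintype.subsetP => _ /mapP[w + ->].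
  rewrite mem_filter => /andP[/andP[/eqP cw dw] /size_words sw].
  have e_sub := word_edge_sub t U w; set e := word_edge t U w in e_sub *.
  have ce : #|e| = d by rewrite card_word_edge ?sw.
  apply/bigcupP; exists [set e; U :\: e]%SET; last by rewrite !inE eqxx.
  rewrite inE cover_pair; apply/andP; split; last first.
    by rewrite -{1}(finset.setIidPr e_sub) finset.setID.
  apply/imset2P; exists e (U :\: e)%SET => //; rewrite !inE ?ce ?eqxx //=.
  rewrite cardsDS // cU ce mul2n -addnn addnK eqxx /=; apply/asboolP.
  exact: crossing_word_edge.
apply: leq_trans (leq_card_cover _) _.
rewrite mul2n -addnn -[X in (_ <= X + _)%N]sum1_card -sum1_card -big_split /=.
apply: leq_sum => P; rewrite inE => /andP[/crossing_pairsP[e [f [-> _ _ _]]] _].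
by rewrite cards2; case: (e != f).
Qed.

Lemma card_subsets k : #|[set U : {set 'I_n} | #|U| == k]%SET| = 'C(n, k).
Proof. by rewrite card_draws card_ord. Qed.

Lemma card_crossing_pairs_ub : (#|crossing_pairs p| <= 'C(n, 2 * d) * 'C(2 * d, d))%N.
Proof.
rewrite card_crossing_pairs.
apply: (@leq_trans (\sum_(U : {set 'I_n} | #|U| == (2 * d)%N) 'C(2 * d, d))%N).
  by apply: leq_sum => U /eqP; apply: card_crossing_pairs_on_ub.
by rewrite sum_nat_cond_const card_subsets.
Qed.

Lemma card_crossing_pairs_lb (t : 'I_n -> R) :
  injective t -> (forall i, p i = moment_point d (t i)) -> (4 <= d)%N ->
  ('C(n, 2 * d) * 'C(2 * d, d) <= 20 * #|crossing_pairs p|)%N.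
Proof.
move=> t_inj pE d4; rewrite card_crossing_pairs big_distrr /=.
apply: (@leq_trans (\sum_(U : {set 'I_n} | #|U| == (2 * d)%N) 'C(2 * d, d))%N); last first.
  by apply: leq_sum => U /eqP; apply: (card_crossing_pairs_on_lb t_inj pE d4).
by rewrite sum_nat_cond_const card_subsets.
Qed.

End CrossingPairs.

Lemma moment_curve_parameters (R : realType) (d n : nat) (p : 'I_n -> 'rV[R]_d) :
  injective p -> (forall i, moment_curve R d (p i)) ->
  exists t : 'I_n -> R, injective t /\ forall i, p i = moment_point d (t i).
Proof.
move=> p_inj p_curve.
have /choice[t tE] : forall i, exists t, p i = moment_point d t.
  by move=> i; have [t _ <-] := p_curve i; exists t.
by exists t; split=> // i j tij; apply: p_inj; rewrite !tE tij.
Qed.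

Lemma central_bin_real_ub (R : realType) (d : nat) : (0 < d)%N ->
  'C(2 * d, d)%:R <= 4%:R ^+ d / Num.sqrt d%:R :> R.
Proof.
move=> d_gt0; have sd : 0 < Num.sqrt (d%:R : R) by rewrite sqrtr_gt0 ltr0n.
rewrite ler_pdivlMr // -(@ler_pXn2r _ 2) ?nnegrE ?mulr_ge0 ?exprn_ge0 ?ler0n ?sqrtr_ge0 //.
rewrite exprMn sqr_sqrtr ?ler0n // -!natrX -natrM ler_nat -expnM [(d * 2)%N]mulnC (expnM 4 2).
apply: leq_trans (central_bin_ub d); rewrite mulnC leq_mul2r; apply/orP; right; lia.
Qed.

Lemma central_bin_real_lb (R : realType) (d : nat) : (0 < d)%N ->
  4%:R ^+ d / Num.sqrt d%:R <= 2 * 'C(2 * d, d)%:R :> R.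
Proof.
move=> d_gt0; have sd : 0 < Num.sqrt (d%:R : R) by rewrite sqrtr_gt0 ltr0n.
rewrite ler_pdivrMr // -(@ler_pXn2r _ 2) ?nnegrE ?mulr_ge0 ?exprn_ge0 ?ler0n ?sqrtr_ge0 //.
rewrite !exprMn sqr_sqrtr ?ler0n // -!natrX -!natrM ler_nat.
rewrite -expnM [(d * 2)%N]mulnC (expnM 4 2).
by apply: leq_trans (central_bin_lb d_gt0) _; rewrite mulnAC.
Qed.

Theorem corollary2 (R : realType) :
  exists (C1 C2 : R) (d0 : nat), 0 < C1 /\ 0 < C2 /\
    forall d n : nat, (2 <= d)%N -> (d0 <= d)%N -> (2 * d <= n)%N ->
    forall p : 'I_n -> 'rV[R]_d,
      injective p -> (forall i : 'I_n, moment_curve R d (p i)) ->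
      C1 * (4%:R ^+ d / Num.sqrt d%:R) * 'C(n, 2 * d)%:R
        <= #|crossing_pairs p|%:R /\
      #|crossing_pairs p|%:R
        <= C2 * (4%:R ^+ d / Num.sqrt d%:R) * 'C(n, 2 * d)%:R.
Proof.
(* 40 = 10 * 2 * 2: the tenth of the words that have enough changes, the two
   words per pair, and the factor 2 of central_bin_real_lb. *)
exists (1 / 40), 1, 4%N; do 2![split; first by lra].
move=> d n d2 d4 _ p p_inj p_curve; have d_gt0 := ltnW d2.
have [t [t_inj pE]] := moment_curve_parameters p_inj p_curve.
split.
  have := card_crossing_pairs_lb t_inj pE d4.
  rewrite -(ler_nat R) !natrM => lb.
  have := ler_wpM2r (ler0n R 'C(n, 2 * d)) (central_bin_real_lb R d_gt0); lra.
have := card_crossing_pairs_ub p; rewrite -(ler_nat R) natrM => ub.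
by rewrite mul1r; apply: le_trans ub _; rewrite mulrC ler_wpM2r ?central_bin_real_ub.
Qed.
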